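(* Let $G=(V,E,w,m,d)$ be a locally finite weighted graph, with $\mathrm{Deg}(x)\le1$ for all $x\in V$, with nonnegative Ollivier curvature, i.e. $\kappa(x,y)\ge0$ for all $x\ne y$ in $V$. Let $V=X\sqcup K\sqcup Y$ with $K$ finite and with no edges between $X$ and $Y$, and let $x_0\in K$. Define $P:\mathbb{R}^K\to\mathbb{R}^K$ by $Pf=\big((\mathrm{id}+\epsilon\Delta)Sf\big)\big|_K$, where $\epsilon>0$ is sufficiently small so that $\mathrm{diag}(\mathrm{id}+\epsilon\Delta)$ is positive on $C_0(\bar K)$. Then for any $f\in Lip(1,K)$ there exists $g\in Lip(1,K)$ such that $$P^nf-P^nf(x_0)\cdot\overrightarrow{1}\to g\quad\text{as }n\to\infty,$$ and $$\Delta Sg\big|_X\ \ge\ \Delta Sg\big|_K\equiv\text{const}\ \ge\ \Delta Sg\big|_Y .$$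
   Context: Weighted graph: $V$ is countable, $w:V\times V\to[0,\infty)$ is symmetric with zero diagonal, $m:V\to(0,\infty)$, and $x\sim y$ (i.e. $(x,y)\in E$) iff $w(x,y)>0$; locally finite means every vertex has finitely many neighbors. $\mathrm{Deg}(x)=\sum_{y\sim x}\frac{w(x,y)}{m(x)}$. $d:V^2\to[0,\infty)$ is a path metric (the graph distance), i.e. $d(x,y)=\inf\{\sum_{i=1}^n d(x_{i-1},x_i):x=x_0\sim\dots\sim x_n=y\}$. The Laplacian is $\Delta f(x)=\frac1{m(x)}\sum_y w(x,y)(f(y)-f(x))$. Ollivier curvature (defined for graphs with $\mathrm{Deg}\le1$): let $\mu_x^1$ be the probability measure with $\mu_x^1(x)=1-\mathrm{Deg}(x)$, $\mu_x^1(z)=w(x,z)/m(x)$ for $z\sim x$, and $0$ elsewhere. Then $\kappa(x,y)=1-\frac{W(\mu_x^1,\mu_y^1)}{d(x,y)}$ for $x\ne y$, where $W(\nu_1,\nu_2)$ is the Wasserstein distance with respect to $d$, i.e. the infimum of $\sum_{u,v}\pi(u,v)d(u,v)$ over couplings $\pi$ of $\nu_1$ and $\nu_2$. $Lip(1,K)=\{f\in\mathbb{R}^K:f(y)-f(x)\le d(x,y)\text{ for all }x,y\in K\}$. The extremal 1-Lipschitz extension $S:\mathbb{R}^K\to\mathbb{R}^V$ is $Sf(x)=f(x)$ for $x\in K$, $Sf(x)=\min_{y\in K}(f(y)+d(x,y))$ for $x\in Y$, and $Sf(x)=\max_{y\in K}(f(y)-d(x,y))$ for $x\in X$. $\bar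 K=K\cup\{x\in V:x\sim y\text{ for some }y\in K\}$ and $C_0(\bar K)$ is the space of functions on $V$ vanishing outside $\bar K$; thus the condition on $\epsilon$ says that the diagonal entries $1-\epsilon\,\mathrm{Deg}(x)$ are positive for $x\in\bar K$. $\overrightarrow{1}$ is the constant function $1$ on $K$. The displayed inequalities mean that $\Delta Sg$ equals a constant $c$ on $K$, is at least $c$ on $X$ and at most $c$ on $Y$. *)

(* Defs.v *)
From HB Require Import structures.
From mathcomp Require Import all_boot all_order all_algebra finmap.
From mathcomp Require Import mathcomp_extra boolp classical_sets functions.
From mathcomp Require Import cardinality fsbigop reals ereal topology normedtype.
From mathcomp Require Import sequences esum.
Set Implicit Arguments.
Unset Strict Implicit.
Unset Printing Implicit Defensive.
Import Order.TTheory GRing.Theory Num.Theory.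
Import numFieldNormedType.Exports.
Local Open Scope classical_set_scope.
Local Open Scope ring_scope.

(* The infimum over paths is taken in [\bar R], where the infimum of the empty
   set is +oo; since [d] is real-valued, [path_metric] therefore entails that
   any two vertices are joined by a path.  The path [x :: p] has edges given by
   [adj], and [pairmap d x p] lists the [d]-lengths of its steps. *)
Definition path_metric (R : realType) (V : countType) (adj : rel V)
    (d : V -> V -> R) : Prop :=
  forall x y : V, (d x y)%:E =
    ereal_inf [set (\sum_(l <- pairmap d x p) l)%:E
              | p in [set p : seq V | path adj x p /\ last x p = y]].

Record wgraph (R : realType) (V : countType) := WGraph {
  wt : V -> V -> R;
  ms : V -> R;
  dist : V -> V -> R;
  wt_ge0 : forall x y, 0 <= wt x y;
  wt_sym : forall x y, wt x y = wt y x;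
  wt_diag : forall x, wt x x = 0;
  ms_gt0 : forall x, 0 < ms x;
  dist_ge0 : forall x y, 0 <= dist x y;
  dist_eq0 : forall x y, dist x y = 0 <-> x = y;
  dist_sym : forall x y, dist x y = dist y x;
  dist_triangle : forall x y z, dist x z <= dist x y + dist y z;
  dist_path : path_metric (fun x y => 0 < wt x y) dist }.

Section Graph.
Variables (R : realType) (V : countType) (G : wgraph R V).
Local Notation w := (wt G).
Local Notation m := (ms G).
Local Notation d := (dist G).

Definition adj : rel V := fun x y => 0 < w x y.

Definition locally_finite : Prop :=
  forall x, finite_set [set y | adj x y].

(* [\sum_(_ \in _)] is meaningful for finitely supported families only: [Deg]
   and [laplacian] are meant for locally finite graphs. *)
Definition Deg (x : V) : R :=
  \sum_(y \in [set y | adj x y]) (w x y / m x).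

Definition laplacian (f : V -> R) (x : V) : R :=
  (m x)^-1 * \sum_(y \in [set: V]) (w x y * (f y - f x)).

Definition coupling (nu1 nu2 : V -> R) (pi : V -> V -> R) : Prop :=
  [/\ forall u v, 0 <= pi u v,
      forall u, \esum_(v in [set: V]) (pi u v)%:E = (nu1 u)%:E &
      forall v, \esum_(u in [set: V]) (pi u v)%:E = (nu2 v)%:E].

Definition wasserstein (nu1 nu2 : V -> R) : \bar R :=
  ereal_inf [set \esum_(p in [set: V * V]) (pi p.1 p.2 * d p.1 p.2)%:E
            | pi in coupling nu1 nu2].

(* Off the neighbours of [x] (and [x] itself) the weight, hence the mass,
   is 0. *)
Definition mu1 (x z : V) : R := if z == x then 1 - Deg x else w x z / m x.

(* If [Deg <= 1] and the graph is locally finite, [mu1 x] and [mu1 y] are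
   finitely supported probabilities, so that their distance is finite. *)
Definition ollivier (x y : V) : R :=
  1 - fine (wasserstein (mu1 x) (mu1 y)) / d x y.

Section Extension.
Variables (K : {fset V}) (X Y : set V).

Definition Lip1 (f : K -> R) : Prop :=
  forall x y : K, f y - f x <= d (val x) (val y).

(* For nonempty [K], [inf] and [sup] range over finite nonempty sets, i.e.
   they are a minimum and a maximum.  The last branch is the case of [x] in
   [X], when [X], [K] and [Y] partition [V]. *)
Definition lipext (f : K -> R) (x : V) : R :=
  if insub x is Some k then f k
  else if x \in Y then inf [set f k + d x (val k) | k in [set: K]]
  else sup [set f k - d x (val k) | k in [set: K]].

Definition vclosure : set V :=
  [set x | x \in K \/ exists2 y, y \in K & adj x y].

Definition heat_step (eps : R) (f : K -> R) : K -> R :=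
  fun k => lipext f (val k) + eps * laplacian (lipext f) (val k).

End Extension.
End Graph.

(* Main.v *)
(* The heat step [P] is monotone, commutes with adding constants, and keeps a
   positive fraction of the value at each vertex.  For such a map on a
   finite-dimensional space, an orbit of bounded oscillation converges modulo
   constants to some [g] with [P g = g + c]: at a limit point the largest and the
   smallest increments of the orbit are constant in time and, by laziness,
   attained at a fixed coordinate over any time span, so that bounded oscillation
   forces them to be equal.

   Nonnegative curvature makes [id + e Delta] preserve 1-Lipschitz functions for
   [e <= 1], which gives bounded oscillation for [e = min(eps, 1)] and hence some
   [g1] with [Delta S g1] constant on [K].  For [eps > 1] the map [P] need not
   preserve [Lip1] (on the dodecahedron with [Deg = 3/4], [K = V] and [eps]
   close to 4/3 it does not), but [g1 + n c] is also an orbit of [P], so orbits still have bounded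
   oscillation and converge.  The limit is 1-Lipschitz because every [g] with
   [Delta S g] constant on [K] is, by a maximum principle at the pairs where the
   Lipschitz condition fails most.  The inequalities on [X] and [Y] hold since
   [S g] grows with slope 1 from a vertex of [X] to some vertex of [K], and from
   some vertex of [K] to a vertex of [Y]. *)

Require Import Defs.
From HB Require Import structures.
From mathcomp Require Import all_boot all_order all_algebra finmap.
From mathcomp Require Import mathcomp_extra boolp classical_sets functions.
From mathcomp Require Import cardinality fsbigop reals ereal topology normedtype.
From mathcomp Require Import sequences esum lra ring.
Set Implicit Arguments.
Unset Strict Implicit.
Unset Printing Implicit Defensive.
Import Order.TTheory GRing.Theory Num.Theory.
Import numFieldNormedType.Exports.
Local Open Scope classical_set_scope.
Local Open Scope ring_scope.

(** * Lazy monotone homogeneous maps *)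

Section LazyMaps.
Variables (R : realType) (K : finType) (k0 : K).
Implicit Types (f g u v : K -> R) (P : (K -> R) -> K -> R).

Lemma finite_ub (F : K -> R) : exists k, forall j, F j <= F k.
Proof. by case: (@arg_maxP _ _ _ k0 predT F isT) => k _ kP; exists k => j; apply: kP. Qed.

Lemma ultra_fmap (T U : Type) (h : T -> U) (F : set_system T) :
  UltraFilter F -> UltraFilter (h @ F).
Proof.
move=> FU; apply: Build_UltraFilter => // G GP FG.
apply/seteqP; split=> // A GA.
have [//|FA] := in_ultra_setVsetC (h @^-1` A) FU.
have GA' : G (~` A) by apply: FG.
have : G (A `&` ~` A) by apply: filterI.
by rewrite setICr => /filter_ex [].
Qed.

(** The right side is [a - de * (a - (f k - g k))]. For [de >= 0] this contains monotonicity and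
    compatibility with constants; moreover a fraction [de] of the slack at [k] survives one step. *)
Definition lazy_map P (de : R) := forall f g a,
  (forall k, f k <= g k + a) ->
  forall k, P f k - P g k <= de * (f k - g k) + (1 - de) * a.

Lemma lazy_mono P de f g a : 0 <= de -> lazy_map P de ->
  (forall k, f k <= g k + a) -> forall k, P f k <= P g k + a.
Proof.
move=> de0 PL fg k; have := PL _ _ _ fg k; have := fg k; nra.
Qed.

Lemma lazy_shift P de f a : 0 <= de -> lazy_map P de ->
  P (fun k => f k + a) = (fun k => P f k + a).
Proof.
move=> de0 PL; apply/funext => k; apply/eqP; rewrite eq_le; apply/andP; split.
  exact: (lazy_mono de0 PL).
have H j : f j <= f j + a + - a by rewrite addrK.
by have := lazy_mono de0 PL H k; rewrite -lerBlDr opprK.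
Qed.

Lemma lazy_iter_mono P de f g a n : 0 <= de -> lazy_map P de ->
  (forall k, f k <= g k + a) -> forall k, iter n P f k <= iter n P g k + a.
Proof. by move=> de0 PL fg; elim: n => //= n; apply: (lazy_mono de0 PL). Qed.

Lemma lazy_iter_shift P de f a n : 0 <= de -> lazy_map P de ->
  iter n P (fun k => f k + a) = (fun k => iter n P f k + a).
Proof. by move=> de0 PL; elim: n => //= n ->; apply: (lazy_shift _ _ de0 PL). Qed.

(** Conjugation by the sign turns smallest increments into largest ones, so that [max_drift] covers
    both. *)
Lemma lazy_opp P de : lazy_map P de -> lazy_map (fun f => \- P (\- f)) de.
Proof.
move=> PL f g a fg k /=.
have H j : (\- g) j <= (\- f) j + a by have := fg j; rewrite /=; lra.
by have := PL _ _ _ H k; rewrite /=; lra.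
Qed.

Lemma iter_opp P f n : iter n (fun f => \- P (\- f)) (\- f) = \- iter n P f.
Proof.
elim: n => //= n ->; congr (\- P _).
by apply/funext => k /=; rewrite opprK.
Qed.

(* The sequence [a] is the normalization of the orbit; [U] is used as an
   ultrafilter finer than [\oo], which replaces the choice of a subsequence. *)
Definition orbit_limit P f (U : set_system nat) (a : nat -> R) g :=
  forall e, 0 < e -> \forall n \near U, forall k,
    `|iter n P f k - a n - g k| <= e.

(** [iter j P] is nonexpansive in the sup norm and commutes with constants, so one normalization
    [a n] serves every shift [j]. *)
Lemma orbit_limit_iter P de f U a g j : 0 <= de -> lazy_map P de -> Filter U ->
  orbit_limit P f U a g ->
  forall e, 0 < e -> \forall n \near U, forall k,
    `|iter (j + n) P f k - a n - iter j P g k| <= e.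
Proof.
move=> de0 PL UF fg e e0; near=> n => k.
have nP : forall k, `|iter n P f k - a n - g k| <= e.
  by near: n; exact: fg.
rewrite iterD ler_norml.
have h1 := @lazy_iter_mono P de (iter n P f) (fun k => g k + a n) e j de0 PL.
have h2 := @lazy_iter_mono P de (fun k => g k + a n) (iter n P f) e j de0 PL.
have H1 : forall k, g k + a n <= iter n P f k + e.
  by move=> i; have := nP i; rewrite ler_norml => /andP[]; lra.
have H2 : forall k, iter n P f k <= g k + a n + e.
  by move=> i; have := nP i; rewrite ler_norml => /andP[]; lra.
move: (h1 H2 k) (h2 H1 k); rewrite !(lazy_iter_shift _ _ _ de0 PL) => ? ?.
by apply/andP; split; lra.
Unshelve. all: by end_near. Qed.

(* The largest increment of an orbit is nonincreasing in time, hence constant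
   along the orbit of a limit point; laziness then makes a single coordinate
   attain it at all times. *)
Lemma max_drift P de f U a g : 0 < de -> lazy_map P de ->
  UltraFilter U -> \oo `<=` U -> orbit_limit P f U a g ->
  exists M, (forall k, P g k <= g k + M) /\
    forall N, exists k, iter N P g k = g k + N%:R * M.
Proof.
move=> de0 PL UU oU fg.
have UP : ProperFilter U := @ultra_proper _ _ UU.
have de0' := ltW de0.
have lim := orbit_limit_iter _ de0' PL _ fg.
pose u n := iter n P f; pose h n := iter n P g.
(* Bounds on all increments at some time. They persist, so [inf D] is the limit of the largest
   increments. *)
pose D := [set M : R | exists n, forall k, u n.+1 k <= u n k + M].
have persist M n m : (forall k, u n.+1 k <= u n k + M) -> (n <= m)%N ->
    forall k, u m.+1 k <= u m k + M.
  move=> nM; elim: m => [|m IH]; first by rewrite leqn0 => /eqP <-.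
  rewrite leq_eqVlt => /orP[/eqP <- //|]; rewrite ltnS => /IH mM.
  exact: (lazy_mono de0' PL).
have [k1 k1P] := finite_ub (fun k => u 1%N k - u 0%N k).
have D0 : D !=set0.
  by exists (u 1%N k1 - u 0%N k1), 0%N => k; have := k1P k; lra.
(* All later increments stay above the smallest initial one; this bounds [D] from below. *)
have [k2 k2P] := finite_ub (fun k => u 0%N k - u 1%N k).
have dn n k : u n k <= u n.+1 k + (u 0%N k2 - u 1%N k2).
  elim: n k => [k|n IH]; first by have := k2P k; lra.
  exact: (lazy_mono de0' PL).
have hinf : has_inf D.
  split=> //; exists (u 1%N k2 - u 0%N k2) => M [n /(_ k2)].
  by have := dn n k2; lra.
pose M := inf D.
have up j k : h j.+1 k <= h j k + M.
  rewrite leNgt; apply/negP => lt.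
  (* A quarter leaves room for three errors: two approximations of the orbit and the excess of [M']
     over [inf D]. *)
  pose e := (h j.+1 k - h j k - M) / 4.
  have e0 : 0 < e by rewrite /e; lra.
  have [M' [n0 nM'] M'e] := inf_adherent e0 hinf.
  have /filter_ex [n [/(_ k) n1 [/(_ k) n2 /= n3]]] :
      \forall n \near U, (forall k, `|iter (j.+1 + n) P f k - a n - h j.+1 k| <= e)
      /\ (forall k, `|iter (j + n) P f k - a n - h j k| <= e) /\ (n0 <= n)%N.
    near=> n; split; first by near: n; exact: lim.
    split; near: n; first exact: lim.
    by apply: oU; exact: nbhs_infty_ge.
  have /(_ k) := persist _ _ (j + n)%N nM' (leq_trans n3 (leq_addl _ _)).
  move: n1 n2 M'e lt; rewrite !ler_norml -/M /e /u /h /=.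
  by move=> /andP[? ?] /andP[? ?] ? ? ?; lra.
have att j : exists k, h j.+1 k = h j k + M.
  have [k kP] := finite_ub (fun k => h j.+1 k - h j k).
  exists k; apply/eqP; rewrite eq_le up andTb leNgt; apply/negP => lt.
  pose e := (M - (h j.+1 k - h j k)) / 4.
  have e0 : 0 < e by rewrite /e; lra.
  have /filter_ex [n [n1 n2]] :
      \forall n \near U, (forall k, `|iter (j.+1 + n) P f k - a n - h j.+1 k| <= e)
      /\ (forall k, `|iter (j + n) P f k - a n - h j k| <= e).
    by near=> n; split; near: n; exact: lim.
  have : D (M - e).
    exists (j + n)%N => i.
    move: (n1 i) (n2 i) (kP i); rewrite !ler_norml /e /u /h /=.
    by move=> /andP[? ?] /andP[? ?] ?; lra.
  move=> /(ge_inf hinf.2); rewrite -/M; lra.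
exists M; split; first exact: (up 0%N).
case=> [|N]; first by exists k0; rewrite mul0r addr0.
have [k kN] := att N; exists k.
(* Slack of coordinate [k] at an early step would survive to step [N], where there is none. *)
suff back j : (j <= N)%N -> h j.+1 k = h j k + M.
  suff /(_ N.+1 (leqnn _)) : forall j, (j <= N.+1)%N -> h j k = g k + j%:R * M by [].
  elim=> [|j IH] jN; first by rewrite mul0r addr0.
  by rewrite back // IH ?(ltnW jN) // -natr1; ring.
move=> jN; have := subnK jN; move: (N - j)%N => i; elim: i j {jN} => [|i IH] j.
  by rewrite add0n => ->.
rewrite addSnnS => /IH eqj; apply/eqP; rewrite eq_le up andTb.
have : h j.+2 k - h j.+1 k <= de * (h j.+1 k - h j k) + (1 - de) * M.
  exact: (PL _ _ _ (up j)).
by rewrite eqj; nra.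
Unshelve. all: by end_near. Qed.

(** Normalized at [k0], every coordinate stays in the compact segment from [- B] to [B], where
    ultrafilters converge. *)
Lemma orbit_limit_exists P f (B : R) :
  (forall n k k', iter n P f k - iter n P f k' <= B) ->
  exists U g, [/\ UltraFilter U, \oo `<=` U &
    orbit_limit P f U (fun n => iter n P f k0) g].
Proof.
move=> bd; have [U [UU oU]] := @ultraFilterLemma _ \oo _.
have UP : ProperFilter U := @ultra_proper _ _ UU.
pose v k n := iter n P f k - iter n P f k0.
have /choice [g gP] : forall k, exists l : R, v k n @[n --> U] --> l.
  move=> k; have := @segment_compact R (- B) B.
  rewrite compact_ultra => /(_ (v k @ U) (ultra_fmap _ UU)) [].
    apply: (@filterE _ U) => n /=; rewrite in_itv /=; apply/andP; split.
      by have := bd n k0 k; rewrite /v; lra.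
    exact: bd.
  by move=> l [_ ul]; exists l.
exists U, g; split=> // e e0; apply: filter_forall => k.
by have /cvgrPdist_le /(_ _ e0) := gP k; apply: filterS => n /=; rewrite distrC.
Qed.

Lemma lazy_orbit_cvg P de f (B : R) : 0 < de -> lazy_map P de ->
  (forall n k k', iter n P f k - iter n P f k' <= B) ->
  exists g c, (forall k, P g k = g k + c) /\
    forall k, (fun n => iter n P f k - iter n P f k0) @ \oo --> g k.
Proof.
move=> de0 PL bd; have de0' := ltW de0.
have [U [g [UU oU fg]]] := orbit_limit_exists bd.
have UP : ProperFilter U := @ultra_proper _ _ UU.
have [M [upM attM]] := max_drift de0 PL UU oU fg.
have fg' : orbit_limit (fun f => \- P (\- f)) (\- f) U
    (fun n => - iter n P f k0) (\- g).
  move=> e e0; apply: filterS (fg _ e0) => n nP k.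
  by rewrite iter_opp /= -[X in X <= _]normrN; apply: le_trans (nP k); rewrite le_eqVlt;
     apply/orP; left; apply/eqP; congr `| _ |; ring.
have [m' [upm attm]] := max_drift de0 (lazy_opp PL) UU oU fg'.
have bdg N k k' : iter N P g k - iter N P g k' <= B.
  apply/ler_addgt0Pr => e e0; have e20 : 0 < e / 2 by lra.
  have /filter_ex [n nP] := orbit_limit_iter N de0' PL (@filter_filter _ _ UP) fg e20.
  move: (nP k) (nP k') (bd (N + n)%N k k').
  by rewrite !ler_norml => /andP[? ?] /andP[? ?]; lra.
(* [- m'] is the smallest increment. Were it below [M], two coordinates of [iter N P g] would drift
   apart by [N * (M + m')], beyond the bound [B]. *)
have Mm : M <= - m'.
  rewrite leNgt; apply/negP => lt.
  have [N NP] : exists N, 2 * B < N%:R * (M + m').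
    exists (Num.truncn (2 * B / (M + m'))).+1.
    by rewrite -ltr_pdivrMr ?truncnS_gt //; lra.
  have [k kP] := attM N; have [k' k'P] := attm N.
  rewrite iter_opp /= in k'P.
  have := bdg N k k'; have := bdg 0%N k' k; rewrite /=; nra.
have eqg k : P g k = g k + M.
  have := upM k; have := upm k; rewrite /=.
  have -> : \- (\- g) = g by apply/funext => i /=; rewrite opprK.
  by lra.
exists g, M; split=> // k; apply/cvgrPdist_le => e e0.
have e20 : 0 < e / 2 by lra.
have itg j : forall k, iter j P g k = g k + j%:R * M.
  elim: j => [|j IH] i; first by rewrite mul0r addr0.
  have -> : iter j.+1 P g = P (fun k => g k + j%:R * M).
    by rewrite /=; congr P; apply/funext.
  by rewrite (lazy_shift _ _ de0' PL) eqg -natr1; ring.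
have gk0 : g k0 = 0.
  apply/eqP; rewrite -normr_eq0 eq_le normr_ge0 andbT; apply/ler_addgt0Pr => d d0.
  by rewrite add0r; have /filter_ex [n /(_ k0)] := fg _ d0; rewrite subrr sub0r normrN.
(* One iterate close to [g] modulo constants suffices: nonexpansiveness keeps all later ones close
   to the orbit [g + j * M]. The value at [k0] costs the second [e / 2]. *)
have /filter_ex [n nP] := fg _ e20.
near=> p; have np : (n <= p)%N by near: p; exact: nbhs_infty_ge.
rewrite -(subnK np) iterD; move: (p - n)%N => j.
have h1 := @lazy_iter_mono P de (iter n P f) (fun k => g k + iter n P f k0) (e / 2) j de0' PL.
have h2 := @lazy_iter_mono P de (fun k => g k + iter n P f k0) (iter n P f) (e / 2) j de0' PL.
have H1 : forall k, g k + iter n P f k0 <= iter n P f k + e / 2.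
  by move=> i; have := nP i; rewrite ler_norml => /andP[]; lra.
have H2 : forall k, iter n P f k <= g k + iter n P f k0 + e / 2.
  by move=> i; have := nP i; rewrite ler_norml => /andP[]; lra.
move: (h1 H2 k) (h1 H2 k0) (h2 H1 k) (h2 H1 k0).
rewrite !(lazy_iter_shift _ _ _ de0' PL) !itg gk0 ler_norml.
by move=> *; apply/andP; split; lra.
Unshelve. all: by end_near. Qed.

End LazyMaps.

(** * Curvature and the Laplacian of Lipschitz functions *)

Section Kantorovich.
Variables (R : realType).

Lemma esum_seq (T : choiceType) (a : T -> R) (r : seq T) : uniq r ->
  (forall i, 0 <= a i) -> (forall i, i \notin r -> a i = 0) ->
  \esum_(i in [set: T]) (a i)%:E = (\sum_(i <- r) a i)%:E.
Proof.
move=> ur a0 ar; rewrite -sumEFin fsbig_seq // -esum_fset //; last first.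
  by move=> i _; rewrite lee_fin.
rewrite [RHS]esum_mkcond; apply: eq_esum => i _.
case: ifPn => // /negP ir; rewrite ar //; apply/negP => ri; apply: ir.
by rewrite inE.
Qed.

Lemma esum_eq0_term (T : choiceType) (a : T -> R) : (forall i, 0 <= a i) ->
  \esum_(i in [set: T]) (a i)%:E = 0%:E -> forall i, a i = 0.
Proof.
move=> a0 sa i; apply/eqP; rewrite eq_le a0 andbT -lee_fin -sa.
apply: esum_ge; exists [set i]; last by rewrite fsbig_set1.
by split=> //; exact: finite_set1.
Qed.

Variables (V : countType) (G : wgraph R V).

(** The easy half of Kantorovich duality: integrate the Lipschitz bound against a coupling, which
    vanishes off [A] times [B]. *)
Lemma kantorovich_le (nu1 nu2 F : V -> R) (A B : seq V) :
  uniq A -> uniq B ->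
  (forall u, u \notin A -> nu1 u = 0) -> (forall v, v \notin B -> nu2 v = 0) ->
  (forall u v, F v - F u <= dist G u v) ->
  ((\sum_(v <- B) nu2 v * F v - \sum_(u <- A) nu1 u * F u)%:E
   <= wasserstein G nu1 nu2)%E.
Proof.
move=> uA uB nu1A nu2B FL; apply/ereal_infP => _ [pi [pi0 pi1 pi2] <-].
have piA u v : u \notin A -> pi u v = 0.
  by move=> uA'; apply: (@esum_eq0_term _ (pi u)) => //; rewrite pi1 nu1A.
have piB u v : v \notin B -> pi u v = 0.
  move=> vB'; apply: (@esum_eq0_term _ (pi ^~ v)) => //; by rewrite pi2 nu2B.
have nu1E u : nu1 u = \sum_(v <- B) pi u v.
  by apply: EFin_inj; rewrite -pi1 (@esum_seq _ _ B) // => v; exact: piB.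
have nu2E v : nu2 v = \sum_(u <- A) pi u v.
  by apply: EFin_inj; rewrite -pi2 (@esum_seq _ _ A) // => u; exact: piA.
rewrite (@esum_seq _ (fun p => pi p.1 p.2 * dist G p.1 p.2)
  [seq (u, v) | u <- A, v <- B]); first last.
- move=> [u v] /=; have [uA'|/piA -> _] := boolP (u \in A); last by rewrite mul0r.
  have [vB'|/piB -> _] := boolP (v \in B); last by rewrite mul0r.
  by rewrite allpairs_f.
- by move=> p; rewrite mulr_ge0 // dist_ge0.
- by apply: allpairs_uniq => // -[? ?] [? ?].
rewrite lee_fin big_allpairs.
have -> : \sum_(v <- B) nu2 v * F v = \sum_(u <- A) \sum_(v <- B) pi u v * F v.
  by rewrite exchange_big; apply: eq_bigr => v _; rewrite nu2E mulr_suml.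
rewrite -sumrB ler_sum // => u _.
rewrite nu1E mulr_suml -sumrB ler_sum // => v _.
by rewrite -mulrBr ler_wpM2l.
Qed.
End Kantorovich.

(** * Neighbour sums, the measures [mu1] and nonnegative curvature *)

Section Curvature.
Variables (R : realType) (V : countType) (G : wgraph R V).
Hypothesis hlf : locally_finite G.

Definition nbr (x : V) : {fset V} := fset_set [set y | adj G x y].

Lemma mem_nbr x y : (y \in nbr x) = adj G x y.
Proof. rewrite in_fset_set; last exact: hlf x.
by apply/idP/idP; rewrite inE.
Qed.

Lemma notin_nbr x : x \notin nbr x.
Proof. by rewrite mem_nbr /adj wt_diag ltxx. Qed.

Lemma wt_notin x y : y \notin nbr x -> wt G x y = 0.
Proof.
by rewrite mem_nbr /adj -leNgt => w0; apply/eqP; rewrite eq_le w0 wt_ge0.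
Qed.

Definition rate (x y : V) : R := wt G x y / ms G x.

Lemma rate_ge0 x y : 0 <= rate x y.
Proof. by rewrite divr_ge0 ?wt_ge0 // ltW // ms_gt0. Qed.

Lemma rate_gt0 x y : y \in nbr x -> 0 < rate x y.
Proof. by rewrite mem_nbr => xy; rewrite divr_gt0 // ms_gt0. Qed.

Lemma DegE x : Deg G x = \sum_(y <- nbr x) rate x y.
Proof. by rewrite /Deg fsbig_finite //; exact: (hlf x). Qed.

Lemma laplacianE F x :
  laplacian G F x = \sum_(y <- nbr x) rate x y * (F y - F x).
Proof.
rewrite /laplacian -(@fsbig_widen _ _ _ _ [set` nbr x]) //; last first.
  by move=> y [_ /negP] /= /wt_notin ->; rewrite mul0r.
rewrite -fsbig_seq ?fset_uniq // mulr_sumr; apply: eq_bigr => y _.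
by rewrite mulrA /rate [_ / _]mulrC.
Qed.

Lemma laplacian_le F H x : (forall z, adj G x z -> F z <= H z) -> F x = H x ->
  laplacian G F x <= laplacian G H x.
Proof.
move=> FH e; rewrite !laplacianE big_seq [leRHS]big_seq; apply: ler_sum => z.
by rewrite mem_nbr => /FH ?; rewrite ler_wpM2l ?rate_ge0 // e lerD2r.
Qed.

(** Strong maximum principle: the difference of the Laplacians is a sum of nonnegative terms with
    positive rates, so each term vanishes. *)
Lemma laplacian_eq_le F H x : (forall z, adj G x z -> F z <= H z) -> F x = H x ->
  laplacian G H x <= laplacian G F x -> forall z, adj G x z -> F z = H z.
Proof.
move=> FH e; rewrite !laplacianE -subr_le0 -sumrB big_seq => s0 z.
rewrite -mem_nbr => xz; have term0 y : y \in nbr x ->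
    0 <= rate x y * (H y - H x) - rate x y * (F y - F x).
  by rewrite mem_nbr => /FH ?; rewrite subr_ge0 ler_wpM2l ?rate_ge0 // e lerD2r.
have : \sum_(i <- nbr x | i \in nbr x)
    (rate x i * (H i - H x) - rate x i * (F i - F x)) == 0.
  by rewrite eq_le s0 sumr_ge0.
rewrite psumr_eq0 // => /allP /(_ _ xz); rewrite xz /= -mulrBr mulf_eq0.
by rewrite gt_eqF ?rate_gt0 //= e => /eqP; lra.
Qed.

Lemma laplacian_opp F x : laplacian G (\- F) x = - laplacian G F x.
Proof.
by rewrite !laplacianE -sumrN; apply: eq_bigr => z _ /=; ring.
Qed.

Lemma laplacian_subr F a x : laplacian G (fun z => F z - a) x = laplacian G F x.
Proof. by rewrite !laplacianE; apply: eq_bigr => z _ /=; ring. Qed.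

Definition cnbr (x : V) : {fset V} := (x |` nbr x)%fset.

Lemma mu1_notin x z : z \notin cnbr x -> mu1 G x z = 0.
Proof.
rewrite in_fset1U negb_or /mu1 => /andP[/negbTE -> zn].
by rewrite wt_notin // mul0r.
Qed.

Lemma average_mu1 F x :
  F x + laplacian G F x = \sum_(z <- cnbr x) mu1 G x z * F z.
Proof.
rewrite big_fsetU1 ?notin_nbr //= {1}/mu1 eqxx DegE laplacianE.
have -> : \sum_(z <- nbr x) mu1 G x z * F z = \sum_(z <- nbr x) rate x z * F z.
  apply: eq_big_seq => z zn; rewrite /mu1.
  by case: eqP zn => // ->; rewrite (negbTE (notin_nbr x)).
under eq_bigr do rewrite mulrBr.
by rewrite sumrB -mulr_suml; ring.
Qed.

Lemma sum_mu1 x : \sum_(z <- cnbr x) mu1 G x z = 1.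
Proof.
have := average_mu1 (fun=> 1) x; rewrite laplacianE big1 => [|z _].
  by rewrite addr0 => ->; apply: eq_bigr => z _; rewrite mulr1.
by rewrite subrr mulr0.
Qed.

Hypothesis hDeg : forall x : V, Deg G x <= 1.

Lemma mu1_ge0 x z : 0 <= mu1 G x z.
Proof. by rewrite /mu1; case: ifP => _; rewrite ?subr_ge0 ?rate_ge0. Qed.

(** The product coupling has finite cost. This matters because [fine] in [ollivier] would send an
    infinite distance to 0. *)
Lemma wasserstein_mu1_lty x y : (wasserstein G (mu1 G x) (mu1 G y) < +oo)%E.
Proof.
pose pi u v := mu1 G x u * mu1 G y v.
pose c := \esum_(p in [set: V * V]) (pi p.1 p.2 * dist G p.1 p.2)%:E.
apply: (@le_lt_trans _ _ c).
  apply: ereal_inf_lbound; exists pi => //; split.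
  - by move=> u v; rewrite mulr_ge0 ?mu1_ge0.
  - move=> u; rewrite (@esum_seq _ _ (pi u) (cnbr y)) ?fset_uniq //.
    + by rewrite -mulr_sumr sum_mu1 mulr1.
    + by move=> v; rewrite mulr_ge0 ?mu1_ge0.
    + by move=> v vn; rewrite /pi (mu1_notin vn) mulr0.
  - move=> v; rewrite (@esum_seq _ _ (pi ^~ v) (cnbr x)) ?fset_uniq //.
    + by rewrite -mulr_suml sum_mu1 mul1r.
    + by move=> u; rewrite mulr_ge0 ?mu1_ge0.
    + by move=> u un; rewrite /pi (mu1_notin un) mul0r.
rewrite /c (@esum_seq _ _ _ [seq (u, v) | u <- cnbr x, v <- cnbr y]) ?ltry //.
- by apply: allpairs_uniq; rewrite ?fset_uniq // => -[? ?] [? ?].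
- by move=> p; rewrite !mulr_ge0 ?mu1_ge0 ?dist_ge0.
- move=> [u v] /=; have [ux|/mu1_notin ux _] := boolP (u \in cnbr x); last first.
    by rewrite /pi ux !mul0r.
  have [vy|/mu1_notin vy _] := boolP (v \in cnbr y); last first.
    by rewrite /pi vy mulr0 mul0r.
  by rewrite allpairs_f.
Qed.

Hypothesis hcurv : forall x y : V, x != y -> 0 <= ollivier G x y.

(** [id + Delta] averages against [mu1]; duality bounds the difference of averages by the
    Wasserstein distance, and curvature bounds that by [dist]. *)
Lemma average_lip (F : V -> R) :
  (forall x y, F y - F x <= dist G x y) ->
  forall x y, (F y + laplacian G F y) - (F x + laplacian G F x) <= dist G x y.
Proof.
move=> FL x y; have [->|xy] := eqVneq x y; first by rewrite subrr dist_ge0.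
have := kantorovich_le (fset_uniq (cnbr x)) (fset_uniq (cnbr y))
  (@mu1_notin x) (@mu1_notin y) FL.
rewrite -!average_mu1.
have d0 : 0 < dist G x y.
  rewrite lt_def dist_ge0 andbT; apply/eqP => /dist_eq0 e.
  by rewrite e eqxx in xy.
have := hcurv xy; rewrite /ollivier subr_ge0 ler_pdivrMr // mul1r.
move: (wasserstein_mu1_lty x y); case: wasserstein => [r _ /= ? | // | //].
by rewrite lee_fin => /le_trans; apply.
Qed.

Lemma laplacian_le_tight (F : V -> R) x y :
  (forall x y, F y - F x <= dist G x y) -> F y - F x = dist G x y ->
  laplacian G F y <= laplacian G F x.
Proof. by move=> FL e; have := average_lip FL x y; lra. Qed.

(** For [eps <= 1] this is a convex combination of [F] and its average. *)
Lemma average_lip_eps (F : V -> R) eps : 0 <= eps <= 1 ->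
  (forall x y, F y - F x <= dist G x y) ->
  forall x y, (F y + eps * laplacian G F y) - (F x + eps * laplacian G F x)
    <= dist G x y.
Proof.
move=> /andP[e0 e1] FL x y; have := average_lip FL x y; have := FL x y; nra.
Qed.

Lemma path_length_ge (F : V -> R) :
  (forall x y, adj G x y -> F y - F x <= dist G x y) ->
  forall x p, path (adj G) x p ->
  F (last x p) - F x <= \sum_(l <- pairmap (dist G) x p) l.
Proof.
move=> FL x p; elim: p x => [|y p IH] x /=; first by rewrite big_nil subrr.
by move=> /andP[/FL xy /IH]; rewrite big_cons; lra.
Qed.

Lemma lip_of_adj (F : V -> R) :
  (forall x y, adj G x y -> F y - F x <= dist G x y) ->
  forall x y, F y - F x <= dist G x y.
Proof.
move=> FL x y; rewrite -lee_fin (dist_path G); apply/ereal_infP.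
by move=> _ [p [xp <-] <-]; rewrite lee_fin; exact: path_length_ge.
Qed.

Lemma adj_closed (A : V -> Prop) x :
  A x -> (forall x y, A x -> adj G x y -> A y) -> forall y, A y.
Proof.
move=> Ax Acl y.
(* Without a path the infimum would be over the empty set, hence infinite, but [dist] is real. *)
have [p [xp <-]] : exists p, path (adj G) x p /\ last x p = y.
  apply: contrapT => np; have := dist_path G x y.
  rewrite (_ : [set _ | _ in _] = set0) ?ereal_inf0 //.
  by apply/seteqP; split=> // t [p xpy _]; apply: np; exists p.
by elim: p x Ax xp => //= z p IH x Ax /andP[xz]; apply: IH; apply: Acl xz.
Qed.
End Curvature.

(** * The extremal Lipschitz extension *)

Lemma inf_image (R : realType) (K : finType) (k0 : K) (F : K -> R) :
  exists k, inf [set F j | j in [set: K]] = F k /\ forall j, F k <= F j.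
Proof.
have [k kP] := finite_ub k0 (\- F).
have kmin j : F k <= F j by have := kP j; rewrite /= lerN2.
exists k; split=> //; apply/eqP; rewrite eq_le; apply/andP; split.
  by apply: ge_inf; [exists (F k) => _ [j _ <-] | exists k].
by apply: lb_le_inf; [exists (F k), k | move=> _ [j _ <-]].
Qed.

Lemma sup_image (R : realType) (K : finType) (k0 : K) (F : K -> R) :
  exists k, sup [set F j | j in [set: K]] = F k /\ forall j, F j <= F k.
Proof.
have [k kP] := finite_ub k0 F.
exists k; split=> //; apply/eqP; rewrite eq_le; apply/andP; split.
  by apply: ge_sup; [exists (F k), k | move=> _ [j _ <-]].
by apply: ub_le_sup; [exists (F k) => _ [j _ <-] | exists k].
Qed.

Section Extension.
Variables (R : realType) (V : countType) (G : wgraph R V) (K : {fset V}) (k0 : K).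
Implicit Types (f g h : K -> R) (Y : set V).
Local Notation d := (dist G).

Lemma lipext_val Y h (k : K) : lipext G Y h (val k) = h k.
Proof. by rewrite /lipext valK. Qed.

Lemma lipext_min Y h x : x \notin K -> Y x ->
  exists k, lipext G Y h x = h k + d x (val k) /\
    forall j, lipext G Y h x <= h j + d x (val j).
Proof.
move=> xK Yx; rewrite /lipext insubN // mem_set //.
have [k [-> kP]] := inf_image k0 (fun k => h k + d x (val k)).
by exists k.
Qed.

Lemma lipext_max Y h x : x \notin K -> ~ Y x ->
  exists k, lipext G Y h x = h k - d x (val k) /\
    forall j, h j - d x (val j) <= lipext G Y h x.
Proof.
move=> xK Yx; rewrite /lipext insubN // memNset //.
have [k [-> kP]] := sup_image k0 (fun k => h k - d x (val k)).
by exists k.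
Qed.

Lemma lipext_mono Y f g a : (forall k, f k <= g k + a) ->
  forall x, lipext G Y f x <= lipext G Y g x + a.
Proof.
move=> fg x; have [xK|xK] := boolP (x \in K).
  by have -> : x = val [` xK]%fset by []; rewrite !lipext_val.
have [Yx|Yx] := pselect (Y x).
  have [k [-> _]] := lipext_min g xK Yx; have [j [_ /(_ k)]] := lipext_min f xK Yx.
  by have := fg k; lra.
have [k [-> _]] := lipext_max f xK Yx; have [j [_ /(_ k)]] := lipext_max g xK Yx.
by have := fg k; lra.
Qed.

Variables (X Y : set V).
Hypothesis hcover : X `|` [set` K] `|` Y = [set: V].
Hypothesis hXK : X `&` [set` K] = set0.
Hypothesis hXY : X `&` Y = set0.
Hypothesis hKY : [set` K] `&` Y = set0.

Lemma notin_X x : X x -> x \notin K.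
Proof. by move=> Xx; apply/negP => Kx; suff : set0 x by []; rewrite -hXK. Qed.

Lemma notin_Y x : Y x -> x \notin K.
Proof. by move=> Yx; apply/negP => Kx; suff : set0 x by []; rewrite -hKY. Qed.

Lemma disjoint_XY x : X x -> ~ Y x.
Proof. by move=> Xx Yx; suff : set0 x by []; rewrite -hXY. Qed.

Variant vertex_spec x : Prop :=
| VertexK (k : K) of x = val k
| VertexX of X x
| VertexY of Y x.

Lemma vertexP x : vertex_spec x.
Proof.
have : [set: V] x by [].
rewrite -hcover => -[[Xx|Kx]|Yx]; [exact: VertexX| |exact: VertexY].
by apply: (@VertexK x [` Kx]%fset).
Qed.

Lemma lipext_X h x : X x -> exists k, lipext G Y h x = h k - d x (val k) /\
    forall j, h j - d x (val j) <= lipext G Y h x.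
Proof. by move=> Xx; apply: lipext_max; [exact: notin_X|exact: disjoint_XY]. Qed.

Lemma lipext_Y h x : Y x -> exists k, lipext G Y h x = h k + d x (val k) /\
    forall j, lipext G Y h x <= h j + d x (val j).
Proof. by move=> Yx; apply: lipext_min => //; exact: notin_Y. Qed.

Lemma lipext_opp h : lipext G X (\- h) = \- lipext G Y h.
Proof.
apply/funext => x /=; have [k ->|Xx|Yx] := vertexP x.
- by rewrite !lipext_val.
- have [k [ek kP]] := lipext_X h Xx.
  have [j [ej jP]] := lipext_min (\- h) (notin_X Xx) Xx.
  by move: (kP j) (jP k); rewrite ek ej /=; lra.
- have [k [ek kP]] := lipext_Y h Yx.
  have nX : ~ X x by move=> /disjoint_XY.
  have [j [ej jP]] := lipext_max (\- h) (notin_Y Yx) nX.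
  by move: (kP j) (jP k); rewrite ek ej /=; lra.
Qed.

Hypothesis hnoedge : forall x y : V, X x -> Y y -> ~~ adj G x y.

Lemma adj_sym x y : adj G x y = adj G y x.
Proof. by rewrite /adj wt_sym. Qed.

(** It suffices to check edges, and the only problematic pairs, between [X] and [Y], are not
    edges. *)
Lemma lipext_lip h : Lip1 G h ->
  forall x y, lipext G Y h y - lipext G Y h x <= d x y.
Proof.
move=> hL; apply: lip_of_adj => x y xy.
have [k ek|Xx|Yx] := vertexP x; have [l el|Xy|Yy] := vertexP y.
- by rewrite ek el !lipext_val.
- have [j [-> _]] := lipext_X h Xy; rewrite ek lipext_val.
  have := hL k j; have := dist_triangle G (val k) y (val j); lra.
- have [_ [_ /(_ k)]] := lipext_Y h Yy; rewrite ek lipext_val.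
  rewrite (dist_sym G (val k)); lra.
- have [_ [_ /(_ l)]] := lipext_X h Xx; rewrite el lipext_val; lra.
- have [j [-> _]] := lipext_X h Xy; have [_ [_ /(_ j)]] := lipext_X h Xx.
  have := dist_triangle G x y (val j); lra.
- by have := hnoedge Xx Yy; rewrite xy.
- have [j [-> _]] := lipext_Y h Yx; rewrite el lipext_val.
  have := hL j l; have := dist_triangle G (val j) x (val l).
  rewrite (dist_sym G (val j) x); lra.
- by have := hnoedge Xy Yx; rewrite adj_sym xy.
- have [j [-> _]] := lipext_Y h Yx; have [_ [_ /(_ j)]] := lipext_Y h Yy.
  have := dist_triangle G y x (val j); rewrite (dist_sym G y x); lra.
Qed.

Hypothesis hlf : locally_finite G.

Lemma heat_stepE eps f k : heat_step G Y eps f k =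
  (1 - eps * Deg G (val k)) * f k +
  eps * \sum_(z <- nbr G (val k)) rate G (val k) z * lipext G Y f z.
Proof.
rewrite /heat_step laplacianE // lipext_val DegE //.
under eq_bigr do rewrite mulrBr.
by rewrite sumrB -mulr_suml; ring.
Qed.

(** The laziness is the diagonal coefficient [1 - eps * Deg]; the neighbours carry the remaining
    weight. *)
Lemma heat_step_lazy eps de : 0 <= eps ->
  (forall k : K, de <= 1 - eps * Deg G (val k)) ->
  lazy_map (@heat_step _ _ G K Y eps) de.
Proof.
move=> e0 deP f g a fg k; rewrite !heat_stepE.
have : \sum_(z <- nbr G (val k)) rate G (val k) z * lipext G Y f z <=
    \sum_(z <- nbr G (val k)) rate G (val k) z * lipext G Y g z +
    Deg G (val k) * a.
  rewrite DegE // mulr_suml -big_split; apply: ler_sum => z _ /=.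
  by rewrite -mulrDr ler_wpM2l ?rate_ge0 // lipext_mono.
move=> /(ler_wpM2l e0); have := fg k; have := deP k.
move: (\sum_(_ <- _) _) (\sum_(_ <- _) _) => s t; nra.
Qed.

Hypothesis hDeg : forall x : V, Deg G x <= 1.
Hypothesis hcurv : forall x y : V, x != y -> 0 <= ollivier G x y.

(* If [g] is not 1-Lipschitz, let [h <= g] be its 1-Lipschitz regularization.
   At a vertex of maximal deviation [g - h = L], comparing Laplacians of the
   extensions of [h] and [g - L] from below and, at the foot of the
   regularizing slope, of [h] and [g] from above, curvature forces
   [S h = S g - L] at all neighbours.  So the vertices of maximal deviation
   have no neighbours in [Y], and near them [g] obeys a maximum principle. *)
Lemma nonlip_lt0 g c :
  (forall k : K, laplacian G (lipext G Y g) (val k) = c) ->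
  ~ Lip1 G g -> c < 0.
Proof.
move=> gc nL.
pose dev (p : K * K) := g p.2 - g p.1 - d (val p.1) (val p.2).
have [[x1 y1] mx] := finite_ub (k0, k0) dev.
pose L := dev (x1, y1).
have devL x y : g y - g x - d (val x) (val y) <= L := mx (x, y).
have L0 : 0 < L.
  rewrite ltNge; apply/negP => L0; apply: nL => x y.
  by have := devL x y; lra.
have /choice [p pP] : forall k : K, exists j : K,
    forall i : K, g j + d (val k) (val j) <= g i + d (val k) (val i).
  move=> k.
  by have [j [_ jP]] := inf_image k0 (fun i : K => g i + d (val k) (val i)); exists j.
pose h k := g (p k) + d (val k) (val (p k)).
have hmin k i : h k <= g i + d (val k) (val i) := pP k i.
have d0 x : d x x = 0 by apply/dist_eq0.
have hg k : h k <= g k + 0 by have := hmin k k; rewrite d0.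
have gh k : g k <= h k + L.
  by have := devL (p k) k; rewrite /h (dist_sym G (val k)); lra.
have hL : Lip1 G h.
  move=> x y; have := hmin y (p x); rewrite /h.
  have := dist_triangle G (val y) (val x) (val (p x)).
  by rewrite (dist_sym G (val y) (val x)); lra.
have Shg z : lipext G Y h z <= lipext G Y g z.
  by have := lipext_mono Y hg z; rewrite addr0.
have Sgh z : lipext G Y g z <= lipext G Y h z + L by exact: lipext_mono.
pose A k := h k = g k - L.
have nbrA y z : A y -> adj G (val y) z ->
    lipext G Y g z - L = lipext G Y h z.
  move=> Ay yz; pose x := p y.
  have hy : h y = g x + d (val y) (val x) by [].
  (* The regularization does not lower [g] at the foot [x], so [(x, y)] is a tight pair for the
     extension of [h]. *)
  have hx : h x = g x.
    apply/eqP; rewrite eq_le; have := hg x; rewrite addr0 => -> /=.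
    by have := hL x y; rewrite hy (dist_sym G (val y)); lra.
  (* With [S] for [lipext]: [Delta S h y <= Delta S h x <= Delta S g x = c = Delta (S g - L) y],
     whereas [S g - L <= S h] with equality at [y]. *)
  apply: (@laplacian_eq_le _ _ G hlf (fun v => lipext G Y g v - L)
    (lipext G Y h) (val y) _ _ _ _ yz) => [v _||].
  - by have := Sgh v; lra.
  - by rewrite !lipext_val Ay.
  - rewrite laplacian_subr // gc -(gc x).
    apply: le_trans (laplacian_le hlf (fun v _ => Shg v) _); last first.
      by rewrite !lipext_val.
    apply: (laplacian_le_tight hlf hDeg hcurv (lipext_lip hL)).
    by rewrite !lipext_val hy hx (dist_sym G (val y)); lra.
have A1 : A y1.
  have := hmin y1 x1; have := gh y1; rewrite /A /L /dev /= (dist_sym G (val y1)).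
  by move=> ? ?; apply/eqP; rewrite eq_le; apply/andP; split; lra.
have /asboolP A1' := A1.
have [a /asboolP Aa amax] := @arg_maxP _ _ _ y1 (fun k => `[< A k >]) g A1'.
have nbr_le y z : A y -> adj G (val y) z -> lipext G Y g z <= g a /\
    (lipext G Y g z = g a -> exists2 k : K, z = val k & A k /\ g k = g a).
  move=> Ay yz; have e := nbrA _ _ Ay yz.
  have maxA k : A k -> g k <= g a by move=> /asboolP; exact: amax.
  have [k ek|Xz|Yz] := vertexP z.
  - move: e; rewrite ek !lipext_val => e; have Ak : A k by rewrite /A e.
    by split; [exact: maxA | exists k].
  (* The vertex [k] realizing the maximum for [g] is again in [A], and [z] lies strictly below
     it. *)
  - have [k [ek _]] := lipext_X g Xz.
    have [_ [_ /(_ k) hk]] := lipext_X h Xz.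
    have Ak : A k by rewrite /A; have := gh k; lra.
    have dk : 0 < d z (val k).
      rewrite lt_def dist_ge0 andbT; apply/eqP => /dist_eq0 zk.
      by have := notin_X Xz; rewrite zk (valP k).
    by have := maxA k Ak; split; lra.
  - have [k [ek _]] := lipext_Y h Yz.
    have [_ [_ /(_ (p k)) gk]] := lipext_Y g Yz.
    have tri := dist_triangle G z (val k) (val (p k)).
    have hk : h k = g (p k) + d (val k) (val (p k)) by [].
    by exfalso; lra.
rewrite ltNge; apply/negP => c0.
pose B z := exists2 k : K, z = val k & A k /\ g k = g a.
(* If [c >= 0], the maximum [g a] spreads to all neighbours, hence to the whole connected graph; a
   constant [g] contradicts [L > 0]. *)
have Ball : forall z, B z.
  apply: (@adj_closed _ _ G B (val a)) => [|_ z [k -> [Ak ka]] kz]; first by exists a.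
  apply: (nbr_le k z Ak kz).2.
  apply: (@laplacian_eq_le _ _ G hlf (lipext G Y g) (fun=> g a) (val k)) => //.
  - by move=> v kv; exact: (nbr_le k v Ak kv).1.
  - by rewrite lipext_val.
  - rewrite gc laplacianE // big1 // => v _; by rewrite subrr mulr0.
have Beq k : g k = g a by have [j /val_inj -> []] := Ball (val k).
by move: L0; rewrite /L /dev /= !Beq; have := dist_ge0 G (val x1) (val y1); lra.
Qed.
End Extension.

(** * Convergence of the heat flow and the inequalities on [X] and [Y] *)

Theorem theorem5 (R : realType) (V : countType) (G : wgraph R V)
    (hlf : locally_finite G)
    (hDeg : forall x : V, Deg G x <= 1)
    (hcurv : forall x y : V, x != y -> 0 <= ollivier G x y)
    (X Y : set V) (K : {fset V})
    (hcover : X `|` [set` K] `|` Y = [set: V])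
    (hXK : X `&` [set` K] = set0)
    (hXY : X `&` Y = set0)
    (hKY : [set` K] `&` Y = set0)
    (hnoedge : forall x y : V, X x -> Y y -> ~~ adj G x y)
    (x0 : K) (eps : R) (heps : 0 < eps)
    (hdiag : forall x : V, vclosure G K x -> 0 < 1 - eps * Deg G x)
    (f : K -> R) (hf : Lip1 G f) :
  exists g : K -> R,
    [/\ Lip1 G g,
        forall k : K,
          (fun n : nat => iter n (heat_step G Y eps) f k
                          - iter n (heat_step G Y eps) f x0) @ \oo --> g k &
        exists c : R,
          [/\ forall x : V, x \in K -> laplacian G (lipext G Y g) x = c,
              forall x : V, X x -> c <= laplacian G (lipext G Y g) x &
              forall x : V, Y x -> laplacian G (lipext G Y g) x <= c]].
Proof.
(* For a non-Lipschitz [g], [nonlip_lt0] gives [c < 0]; applied to [\- g] with [X] and [Y] exchanged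
   it gives [- c < 0]. *)
have harmonic_lip (g : K -> R) c :
    (forall k : K, laplacian G (lipext G Y g) (val k) = c) -> Lip1 G g.
  move=> gc; apply: contrapT => nL.
  have c0 := nonlip_lt0 x0 hcover hXK hXY hKY hnoedge hlf hDeg hcurv gc nL.
  have hcover' : Y `|` [set` K] `|` X = [set: V].
    by rewrite -hcover setUC setUA setUAC.
  have hnoedge' x y : Y x -> X y -> ~~ adj G x y.
    by rewrite adj_sym => Yx Xy; exact: hnoedge.
  have gc' (k : K) : laplacian G (lipext G X (\- g)) (val k) = - c.
    by rewrite (lipext_opp G x0 hcover hXK hXY hKY) laplacian_opp // gc.
  have nL' : ~ Lip1 G (\- g).
    by move=> gL; apply: nL => x y; have := gL y x; rewrite dist_sym /=; lra.
  have := nonlip_lt0 x0 hcover' _ _ _ hnoedge' hlf hDeg hcurv gc' nL'.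
  by rewrite setIC hKY setIC hXY setIC hXK => /(_ erefl erefl erefl); lra.
have diagK e : 0 < e <= eps -> exists2 de, 0 < de &
    forall k : K, de <= 1 - e * Deg G (val k).
  move=> /andP[e0 ee].
  have [k kP] := finite_ub x0 (fun k : K => Deg G (val k)).
  exists (1 - e * Deg G (val k)).
    have := hdiag (val k) (or_introl (valP k)); have : 0 <= Deg G (val k).
      by rewrite DegE // sumr_ge0 // => z _; exact: rate_ge0.
    by nra.
  by move=> j; have := kP j; nra.
have heat_fix e (g : K -> R) c : e != 0 ->
    (forall k, heat_step G Y e g k = g k + c) ->
    forall k : K, laplacian G (lipext G Y g) (val k) = c / e.
  move=> e0 gc k; have := gc k; rewrite /heat_step lipext_val => /addrI <-.
  by rewrite mulrAC divff ?mul1r.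
pose e1 := Num.min eps 1.
have e1P : 0 < e1 <= eps by rewrite /e1 lt_min heps ltr01 ge_min lexx.
have e11 : 0 <= e1 <= 1 by rewrite (ltW (andP e1P).1) ge_min lexx orbT.
have [d1 d10 d1P] := diagK e1 e1P.
have [g1 [c1 g1c]] : exists (g1 : K -> R) (c1 : R),
    forall k : K, laplacian G (lipext G Y g1) (val k) = c1.
  have orbL n : Lip1 G (iter n (heat_step G Y e1) f).
    elim: n => //= n IH x y.
    have SL := lipext_lip x0 hcover hXK hXY hKY hnoedge IH.
    exact: (average_lip_eps hlf hDeg hcurv e11 SL).
  have [[k k'] kP] := finite_ub (x0, x0) (fun p => dist G (val p.1) (val p.2)).
  have [|g1 [c1 [g1c _]]] := @lazy_orbit_cvg _ _ x0 _ d1 f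
      (dist G (val k) (val k')) d10 (heat_step_lazy x0 Y hlf (ltW (andP e1P).1) d1P).
    by move=> n i j; apply: le_trans (orbL n j i) (kP (j, i)).
  by exists g1, (c1 / e1); apply: heat_fix g1c; rewrite gt_eqF ?(andP e1P).1.
have [|de de0 deP] := diagK eps; first by rewrite heps lexx.
have lazyP := heat_step_lazy x0 Y hlf (ltW heps) deP.
(* Constancy of the Laplacian does not involve the step size, so [g1], found with step [e1], drifts
   uniformly under step [eps] too. *)
have iter_g1 n : iter n (heat_step G Y eps) g1 = (fun k => g1 k + n%:R * (eps * c1)).
  elim: n => [|n IH]; apply/funext => k /=; first by rewrite mul0r addr0.
  rewrite IH (lazy_shift _ _ (ltW de0) lazyP) /heat_step lipext_val g1c -natr1.
  by ring.
have [kf kfP] := finite_ub x0 (fun k => `|f k - g1 k|).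
have [kg kgP] := finite_ub x0 (fun k => `|g1 k|).
(* The orbit of [f] stays within [a] of that of [g1], whose oscillation is at most [2 * b]. *)
pose a := `|f kf - g1 kf|; pose b := `|g1 kg|.
have [|g [c [gc gcvg]]] := @lazy_orbit_cvg _ _ x0 _ de f (2 * a + 2 * b) de0 lazyP.
  move=> n k k'.
  have H1 i : f i <= g1 i + a by have := kfP i; rewrite -/a ler_norml; lra.
  have H2 i : g1 i <= f i + a by have := kfP i; rewrite -/a ler_norml; lra.
  have := lazy_iter_mono n (ltW de0) lazyP H1 k.
  have := lazy_iter_mono n (ltW de0) lazyP H2 k'.
  move: (kgP k) (kgP k'); rewrite -/b iter_g1 !ler_norml.
  by move=> /andP[? ?] /andP[? ?]; lra.
have Lg := heat_fix eps g c (lt0r_neq0 heps) gc.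
have gL := harmonic_lip g _ Lg.
have SL := lipext_lip x0 hcover hXK hXY hKY hnoedge gL.
exists g; split=> //; exists (c / eps); split.
- by move=> x Kx; exact: (Lg [` Kx]%fset).
(* The vertex [k] realizing the maximum forms a tight pair with [x]. *)
- move=> x Xx; have [k [ek _]] := lipext_X G x0 hXK hXY g Xx; rewrite -(Lg k).
  by apply: (laplacian_le_tight hlf hDeg hcurv SL); rewrite lipext_val ek; lra.
- move=> x Yx; have [k [ek _]] := lipext_Y G x0 hKY g Yx; rewrite -(Lg k).
  apply: (laplacian_le_tight hlf hDeg hcurv SL).
  by rewrite lipext_val ek (dist_sym G x); lra.
Qed.
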